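(* Let $\Omega=[a,b]$ and let $(w,p_w)$ be a sufficiently smooth solution of the implicit Euler--Bernoulli system $$\begin{bmatrix}\partial_tw\\\partial_tp_w\end{bmatrix}=\begin{bmatrix}0&\mathrm{Id}\\-\mathrm{Id}&0\end{bmatrix}\begin{bmatrix}\delta_w\mathcal{H}_c^I\\\delta_{p_w}\mathcal{H}_c^I\end{bmatrix},\qquad \mathcal{H}_c^I=\frac12\int_\Omega\Big(\frac1{\rho A}p_w^2+T_0(\partial_xw)^2+EI(\partial_{x^2}^2w)^2\Big)dx.$$ Then $$\frac{d}{dt}\mathcal{H}_c^I=\big[\partial_tw\,\big(T_0\,\partial_xw-\partial_x(EI\,\partial_{x^2}^2w)\big)+\partial_t(\partial_xw)\,EI\,\partial_{x^2}^2w\big]_a^b.$$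
   Context: $\rho,A,T_0,I,E$ are positive time-independent physical parameters (mass density, cross-section area, tension, moment of inertia, Young's modulus). The (weak) variational derivatives, i.e. those obtained by testing against smooth functions compactly supported in the interior of $\Omega$, are $$\delta_w\mathcal{H}_c^I=-\partial_x(T_0\partial_xw)+\partial_{x^2}^2(EI\,\partial_{x^2}^2w),\qquad \delta_{p_w}\mathcal{H}_c^I=\frac{p_w}{\rho A}.$$ $[g]_a^b:=g(b)-g(a)$. No boundary conditions are imposed. *)

(* Defs.v *)
From Stdlib Require Export Reals.
From Coquelicot Require Export Coquelicot.
Open Scope R_scope.

(* Functions of time and space are curried, time first. *)
Definition Dt (f : R -> R -> R) : R -> R -> R :=
  fun t x => Derive (fun s => f s x) t.

Definition Dx (f : R -> R -> R) : R -> R -> R :=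
  fun t x => Derive (fun y => f t y) x.

Definition C_on (U : R -> Prop) (k : nat) (f : R -> R) : Prop :=
  forall x, U x ->
    (forall j, (j <= k)%nat -> ex_derive_n f j x) /\
    continuous (Derive_n f k) x.

Fixpoint C2_on (U : R * R -> Prop) (k : nat) (f : R -> R -> R) : Prop :=
  (forall t x, U (t, x) -> continuity_2d_pt f t x) /\
  match k with
  | O => True
  | S k' =>
      (forall t x, U (t, x) ->
         ex_derive (fun s => f s x) t /\ ex_derive (fun y => f t y) x) /\
      C2_on U k' (Dt f) /\ C2_on U k' (Dx f)
  end.

(* Smoothness up to the end points of [a, b] means being C^k on some open
   neighbourhood, so that the two-sided [Derive] is meaningful at a and b and
   agrees with the one-sided derivative there. *)
Definition C_segment (a b : R) (k : nat) (f : R -> R) : Prop :=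
  exists U : R -> Prop,
    open U /\ (forall x, a <= x <= b -> U x) /\ C_on U k f.

Definition C_strip (t0 t1 a b : R) (k : nat) (f : R -> R -> R) : Prop :=
  exists U : R * R -> Prop,
    open U /\ (forall t x, t0 < t < t1 -> a <= x <= b -> U (t, x)) /\
    C2_on U k f.

Definition hamiltonian (a b : R) (rho A T0 I E : R -> R) (u q : R -> R) : R :=
  / 2 * RInt (fun x => / (rho x * A x) * q x ^ 2
                       + T0 x * (Derive u x) ^ 2
                       + E x * I x * (Derive_n u 2 x) ^ 2) a b.

Definition test_function (a b : R) (phi : R -> R) : Prop :=
  (forall n x, ex_derive_n phi n x) /\
  exists c d, a < c /\ d < b /\ forall x, x < c \/ d < x -> phi x = 0.

Definition is_weak_variational_derivative
    (a b : R) (F : (R -> R) -> R) (u g : R -> R) : Prop :=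
  ex_RInt g a b /\
  forall phi, test_function a b phi ->
    is_derive (fun eps => F (fun x => u x + eps * phi x)) 0
              (RInt (fun x => g x * phi x) a b).

(* For smooth data, integration by parts and the fundamental lemma of the
   calculus of variations show that the continuous weak variational derivatives
   are dwH = - (T0 w')' + (E I w'')'' and dpH = p / (rho A). *)
Definition euler_bernoulli (t0 t1 a b : R) (rho A T0 I E : R -> R)
    (w p : R -> R -> R) : Prop :=
  forall t, t0 < t < t1 ->
    exists dwH dpH : R -> R,
      is_weak_variational_derivative a b
        (fun u => hamiltonian a b rho A T0 I E u (p t)) (w t) dwH /\
      is_weak_variational_derivative a b
        (fun q => hamiltonian a b rho A T0 I E (w t) q) (p t) dpH /\
      forall x, a <= x <= b ->
        Dt w t x = dpH x /\ Dt p t x = - dwH x.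

Definition bracket (a b : R) (g : R -> R) : R := g b - g a.

(* Main.v *)
From Stdlib Require Import Lra Lia Factorial.
Require Import Defs.

(* Bump functions of the form e^(-1/(x-c)) e^(-1/(d-x)) give the fundamental
   lemma of the calculus of variations, so the weak variational derivatives are
   the classical ones: w_t = p / (rho A) and p_t = (T0 w_x)_x - (E I w_xx)_xx.
   The same integration by parts
     int ((N' - M'') v + N v' + M v'') = [v (N - M') + v' M],
   with N = T0 w_x and M = E I w_xx, serves twice: with v a test function it
   identifies the variational derivative, and with v = w_t it turns the time
   derivative of the energy, taken under the integral sign, into the boundary
   terms. *)

(** * Pointwise $C^k$ regularity in one variable *)

(** The recursion peels derivatives off from the inside, so the closure properties below are
    inductions that generalise over the function. Derivatives are asked to exist near [x], but the
    last one is asked to be continuous only at [x]. *)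
Fixpoint C_at (k : nat) (f : R -> R) (x : R) : Prop :=
  match k with
  | O => continuous f x
  | S k' => locally x (ex_derive f) /\ C_at k' (Derive f) x
  end.

Lemma C_at_ex_derive k f x : C_at (S k) f x -> ex_derive f x.
Proof. intros [H _]. exact (locally_singleton _ _ H). Qed.

Lemma C_at_continuous k f x : C_at k f x -> continuous f x.
Proof.
  destruct k; [easy|]. intros H.
  exact (ex_derive_continuous f x (C_at_ex_derive k f x H)).
Qed.

Lemma C_at_ext_loc k f g x :
  locally x (fun y => f y = g y) -> C_at k f x -> C_at k g x.
Proof.
  revert f g; induction k as [|k IH]; intros f g Hfg.
  - apply continuous_ext_loc.
    now apply filter_imp with (2 := Hfg).
  - intros [Hd Hc]; apply locally_locally in Hfg; split.
    + generalize (filter_and _ _ Hfg Hd); apply filter_imp.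
      intros y [H1 H2]. exact (ex_derive_ext_loc f g y H1 H2).
    + apply (IH (Derive f)); [|exact Hc].
      generalize Hfg; apply filter_imp.
      intros y H1. exact (Derive_ext_loc f g y H1).
Qed.

Lemma C_at_S_pred k f x : C_at (S k) f x -> C_at k f x.
Proof.
  revert f; induction k as [|k IH]; intros f H.
  - exact (C_at_continuous 1 f x H).
  - destruct H as [H1 H2]. split; [exact H1|]. now apply IH.
Qed.

Lemma C_at_const k c x : C_at k (fun _ => c) x.
Proof.
  revert c; induction k as [|k IH]; intros c.
  - apply continuous_const.
  - split.
    + apply filter_forall; intros y; apply ex_derive_const.
    + apply (C_at_ext_loc k (fun _ => 0)); [|apply IH].
      apply filter_forall; intros y; symmetry; apply Derive_const.
Qed.

Lemma C_at_plus k f g x :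
  C_at k f x -> C_at k g x -> C_at k (fun y => f y + g y) x.
Proof.
  revert f g; induction k as [|k IH]; intros f g.
  - intros Hf Hg. exact (continuous_plus f g x Hf Hg).
  - intros [Hf Hf'] [Hg Hg']. assert (H := filter_and _ _ Hf Hg). split.
    + generalize H; apply filter_imp; intros y [H1 H2].
      exact (ex_derive_plus f g y H1 H2).
    + apply C_at_ext_loc with (2 := IH _ _ Hf' Hg').
      generalize H; apply filter_imp; intros y [H1 H2].
      symmetry. exact (Derive_plus f g y H1 H2).
Qed.

Lemma C_at_mult k f g x :
  C_at k f x -> C_at k g x -> C_at k (fun y => f y * g y) x.
Proof.
  revert f g; induction k as [|k IH]; intros f g.
  - intros Hf Hg. exact (continuous_mult f g x Hf Hg).
  - intros Hf0 Hg0.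
    (* In $f'g + fg'$ the undifferentiated factors have one order to spare, and the induction
       hypothesis needs both factors at order [k]. *)
    assert (Hfk := C_at_S_pred _ _ _ Hf0). assert (Hgk := C_at_S_pred _ _ _ Hg0).
    destruct Hf0 as [Hf Hf'], Hg0 as [Hg Hg'].
    assert (H := filter_and _ _ Hf Hg). split.
    + generalize H; apply filter_imp; intros y [H1 H2].
      now apply ex_derive_mult.
    + apply C_at_ext_loc with
        (2 := C_at_plus _ _ _ _ (IH _ _ Hf' Hgk) (IH _ _ Hfk Hg')).
      generalize H; apply filter_imp; intros y [H1 H2].
      symmetry. now apply Derive_mult.
Qed.

Lemma C_at_comp_affine k f m c x :
  C_at k f (m * x + c) -> C_at k (fun y => f (m * y + c)) x.
Proof.
  assert (Haff : forall y, is_derive (fun z => m * z + c) y m).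
  { intros y. auto_derive; [easy|ring]. }
  assert (Hcont : continuous (fun y => m * y + c) x).
  { apply (ex_derive_continuous (fun y => m * y + c)). now exists m. }
  revert f; induction k as [|k IH]; intros f.
  - intros H. apply (continuous_comp (fun y => m * y + c) f); [|exact H].
    exact Hcont.
  - intros [Hd Hc].
    assert (Hd' : locally x (fun y => ex_derive f (m * y + c))).
    { exact (Hcont _ Hd). }
    split.
    + generalize Hd'; apply filter_imp; intros y Hy.
      apply (ex_derive_comp f (fun z => m * z + c)); [exact Hy|now exists m].
    + apply C_at_ext_loc with
        (2 := C_at_mult _ _ _ _ (C_at_const k m x) (IH _ Hc)).
      generalize Hd'; apply filter_imp; intros y Hy.
      symmetry. apply is_derive_unique.
      apply (is_derive_comp f (fun z => m * z + c)); [|apply Haff].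
      now apply Derive_correct.
Qed.

Lemma C_at_ex_derive_n k f x : C_at k f x -> ex_derive_n f k x.
Proof.
  revert f; induction k as [|[|k] IH]; intros f H.
  - exact Logic.I.
  (* Order 1 is separate: the induction hypothesis would only give [ex_derive_n _ 0], which is
     [True]. *)
  - exact (C_at_ex_derive 0 f x H).
  - apply (ex_derive_ext (Derive_n (Derive f) k)); [|exact (IH _ (proj2 H))].
    (* [Derive_n] adds derivatives on the outside, [C_at] on the inside; composing iterated
       derivatives reconciles the two. *)
    intros y. rewrite (Derive_n_comp f k 1). f_equal. lia.
Qed.

Lemma C_at_Derive k f x : C_at (S k) f x -> C_at k (Derive f) x.
Proof. intros [_ H]. exact H. Qed.

Lemma C_at_derive_n k n f x : C_at (n + k) f x -> C_at k (Derive_n f n) x.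
Proof.
  revert k; induction n as [|n IH]; intros k H; [exact H|].
  apply (IH (S k)). now rewrite Nat.add_succ_r.
Qed.

(** Openness of [U] turns differentiability at every point of [U] into differentiability near
    [x]. *)
Lemma C_on_C_at U k f x : open U -> C_on U k f -> U x -> C_at k f x.
Proof.
  intros HU. revert f; induction k as [|k IH]; intros f Hf Hx.
  - exact (proj2 (Hf x Hx)).
  - split.
    + apply filter_imp with (2 := HU x Hx).
      intros y Hy. exact (proj1 (Hf y Hy) 1%nat ltac:(lia)).
    + apply IH; [|exact Hx]. intros y Hy. split.
      * intros [|j] Hj; [exact Logic.I|].
        apply (ex_derive_ext (Derive_n f (S j))).
        -- intros z. rewrite (Derive_n_comp f j 1). f_equal. lia.
        -- exact (proj1 (Hf y Hy) (S (S j)) ltac:(lia)).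
      * apply (continuous_ext (Derive_n f (S k))); [|exact (proj2 (Hf y Hy))].
        intros z. rewrite (Derive_n_comp f k 1). f_equal. lia.
Qed.

Lemma C_segment_C_at a b k f x :
  C_segment a b k f -> a <= x <= b -> C_at k f x.
Proof.
  intros [U [HU [HI Hf]]] Hx. apply (C_on_C_at U); auto.
Qed.

(** * A smooth bump function *)

(* The family x^-n e^(-1/x), extended by 0, is stable under differentiation:
   flat n' = - n flat (n+1) + flat (n+2). This yields smoothness at 0 by a single
   induction. *)
Definition flat (n : nat) (x : R) : R :=
  if Rle_dec x 0 then 0 else (/ x) ^ n * exp (- / x).

Lemma flat_nonpos n x : x <= 0 -> flat n x = 0.
Proof. intros H. unfold flat. now destruct (Rle_dec x 0). Qed.

Lemma flat_pos_eq n x : 0 < x -> flat n x = (/ x) ^ n * exp (- / x).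
Proof. intros H. unfold flat. destruct (Rle_dec x 0); [lra|easy]. Qed.

Lemma flat_pos n x : 0 < x -> 0 < flat n x.
Proof.
  intros H. rewrite flat_pos_eq by easy.
  apply Rmult_lt_0_compat; [|apply exp_pos].
  apply pow_lt. now apply Rinv_0_lt_compat.
Qed.

(** With $y = 1/x$, the bound $e^y \ge y^{n+2}/(n+2)!$ gives $y^n e^{-y} \le (n+2)!\,y^{-2}$. A
    quadratic bound is what makes the difference quotient at 0 tend to 0. *)
Lemma flat_le_sqr n x : Rabs (flat n x) <= INR (fact (n + 2)) * x ^ 2.
Proof.
  assert (HF : 0 < INR (fact (n + 2))) by apply INR_fact_lt_0.
  destruct (Rle_lt_dec x 0) as [H|H].
  - rewrite flat_nonpos, Rabs_R0 by easy.
    apply Rmult_le_pos; [lra|apply pow2_ge_0].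
  - rewrite Rabs_pos_eq by now apply Rlt_le, flat_pos.
    rewrite flat_pos_eq by easy. set (y := / x).
    assert (Hy : 0 < y) by now apply Rinv_0_lt_compat.
    assert (Hexp : y ^ (n + 2) / INR (fact (n + 2)) <= exp y).
    (* Only the last term of the Taylor sum is kept; the others are nonnegative. *)
    { refine (Rle_trans _ _ _ _ (exp_ge_taylor y (n + 2) (Rlt_le _ _ Hy))).
      replace (n + 2)%nat with (S (n + 1)) by lia. rewrite tech5.
      rewrite <- (Rplus_0_l (_ / _)) at 1. apply Rplus_le_compat_r.
      apply cond_pos_sum. intros k.
      apply Rmult_le_pos; [apply pow_le; lra|].
      apply Rlt_le, Rinv_0_lt_compat, INR_fact_lt_0. }
    assert (Hp := exp_pos y).
    rewrite exp_Ropp. apply Rle_div_l in Hexp; [|easy].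
    apply (Rmult_le_reg_r (exp y * y ^ 2)).
    { apply Rmult_lt_0_compat; [easy|]. apply pow_lt; easy. }
    replace (y ^ n * / exp y * (exp y * y ^ 2)) with (y ^ (n + 2)).
    2:{ rewrite pow_add. field. lra. }
    replace (INR (fact (n + 2)) * x ^ 2 * (exp y * y ^ 2))
      with (exp y * INR (fact (n + 2))); [easy|].
    unfold y. field. lra.
Qed.

Lemma is_derive_flat n x :
  is_derive (flat n) x (- INR n * flat (S n) x + flat (S (S n)) x).
Proof.
  destruct (total_order_T x 0) as [[H|H]|H].
  - rewrite !(flat_nonpos _ x) by lra.
    replace (- INR n * 0 + 0) with 0 by ring.
    apply (is_derive_ext_loc (fun _ => 0)); [|apply @is_derive_const].
    apply filter_imp with (2 := open_lt 0 x H).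
    intros y Hy. symmetry. apply flat_nonpos. lra.
  - subst x. rewrite !(flat_nonpos _ 0) by lra.
    replace (- INR n * 0 + 0) with 0 by ring.
    apply is_derive_Reals. intros eps Heps.
    assert (HF : 0 < INR (fact (n + 2))) by apply INR_fact_lt_0.
    (* For $h \ne 0$ the difference quotient at 0 is at most $(n+2)!\,|h|$ in absolute value. *)
    assert (Hd : 0 < eps / INR (fact (n + 2))) by now apply Rdiv_lt_0_compat.
    exists (mkposreal _ Hd). intros h Hh Hlt. simpl in Hlt.
    rewrite Rplus_0_l, (flat_nonpos n 0) by lra.
    rewrite !Rminus_0_r. unfold Rdiv at 1. rewrite Rabs_mult, Rabs_inv.
    assert (Hh' := Rabs_pos_lt h Hh).
    apply Rlt_div_l; [easy|].
    apply Rle_lt_trans with (1 := flat_le_sqr n h).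
    rewrite <- pow2_abs.
    apply Rlt_div_r in Hlt; [|easy]. nra.
  - rewrite !(flat_pos_eq _ x) by easy.
    apply (is_derive_ext_loc (fun y => (/ y) ^ n * exp (- / y))).
    + apply filter_imp with (2 := open_gt 0 x H).
      intros y Hy. symmetry. now apply flat_pos_eq.
    + auto_derive; [repeat split; lra|].
      destruct n as [|n]; [simpl; field; lra|].
      rewrite S_INR. simpl. field. lra.
Qed.

Lemma C_at_flat k n x : C_at k (flat n) x.
Proof.
  revert n; induction k as [|k IH]; intros n.
  - apply (ex_derive_continuous (flat n)). eexists. apply is_derive_flat.
  - split.
    + apply filter_forall. intros y. eexists. apply is_derive_flat.
    + apply (C_at_ext_loc k
        (fun y => - INR n * flat (S n) y + flat (S (S n)) y)).
      * apply filter_forall. intros y. symmetry.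
        apply is_derive_unique, is_derive_flat.
      * apply C_at_plus; [|apply IH].
        apply C_at_mult; [apply C_at_const|apply IH].
Qed.

Lemma bump_exists a b c d :
  a < c -> c < d -> d < b ->
  exists phi, test_function a b phi /\
    (forall x, x <= c \/ d <= x -> phi x = 0) /\
    (forall x, c < x < d -> 0 < phi x).
Proof.
  intros Hac Hcd Hdb.
  (* The factors are $e^{-1/(x-c)}$ and $e^{-1/(d-x)}$ extended by 0, with arguments written as
     [m * x + c] to fit [C_at_comp_affine]. *)
  exists (fun x => flat 0 (1 * x + - c) * flat 0 (-1 * x + d)).
  assert (H0 : forall x, x <= c \/ d <= x ->
    flat 0 (1 * x + - c) * flat 0 (-1 * x + d) = 0).
  { intros x [H|H].
    - rewrite (flat_nonpos 0 (1 * x + - c)) by lra. ring.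
    - rewrite (flat_nonpos 0 (-1 * x + d)) by lra. ring. }
  split; [split|split].
  - intros n x. apply C_at_ex_derive_n.
    apply C_at_mult; apply (C_at_comp_affine n (flat 0)), C_at_flat.
  - exists c, d. repeat split; [easy|easy|]. intros x H. apply H0. lra.
  - exact H0.
  - intros x H. apply Rmult_lt_0_compat; apply flat_pos; lra.
Qed.

(** * The fundamental lemma of the calculus of variations *)

Lemma test_function_continuous a b phi x :
  test_function a b phi -> continuous phi x.
Proof.
  intros [H _]. apply (ex_derive_continuous phi). exact (H 1%nat x).
Qed.

Lemma ex_RInt_continuous_le (f : R -> R) a b :
  a <= b -> (forall x, a <= x <= b -> continuous f x) -> ex_RInt f a b.
Proof.
  intros Hab H. apply (ex_RInt_continuous (V := R_CompleteNormedModule)).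
  now rewrite Rmin_left, Rmax_right.
Qed.

Lemma RInt_ext_le (f g : R -> R) a b :
  a <= b -> (forall x, a <= x <= b -> f x = g x) -> RInt f a b = RInt g a b.
Proof.
  intros Hab H. apply RInt_ext. rewrite Rmin_left, Rmax_right by easy.
  intros x Hx. apply H. lra.
Qed.

(** If $g(x) > 0$, then $g > 0$ near $x$ by continuity, and a bump supported there would have a
    positive integral against $g$. The point $x$ may be an end point. *)
Lemma fundamental_lemma_pos a b g x :
  a < b -> (forall y, a <= y <= b -> continuous g y) ->
  (forall phi, test_function a b phi -> RInt (fun y => g y * phi y) a b = 0) ->
  a <= x <= b -> ~ 0 < g x.
Proof.
  intros Hab Hg H0 Hx Hpos.
  destruct (Hg x Hx (fun z => 0 < z) (open_gt 0 _ Hpos)) as [eps He].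
  assert (Heps := cond_pos eps).
  set (l := Rmax a (x - eps)). set (r := Rmin b (x + eps)).
  assert (Hl : a <= l /\ x - eps <= l) by (split; [apply Rmax_l|apply Rmax_r]).
  assert (Hr : r <= b /\ r <= x + eps) by (split; [apply Rmin_l|apply Rmin_r]).
  assert (Hlr : l < r).
  { apply Rmax_lub_lt; apply Rmin_glb_lt; lra. }
  (* The middle third of $[l, r]$ lies strictly inside $(a, b)$ even when $x$ is an end point; it
     need not contain $x$. *)
  set (c := (2 * l + r) / 3). set (d := (l + 2 * r) / 3).
  assert (Hc : l < c < d) by (unfold c, d; lra).
  assert (Hd : c < d < r) by (unfold c, d; lra).
  destruct (bump_exists a b c d) as [phi [Hphi [Hz Hp]]]; try lra.
  assert (Hcont : forall y, a <= y <= b -> continuous (fun z => g z * phi z) y).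
  { intros y Hy. apply (continuous_mult g phi); [now apply Hg|].
    now apply test_function_continuous with a b. }
  assert (Hint : forall u v, a <= u -> u <= v -> v <= b ->
    ex_RInt (fun z => g z * phi z) u v).
  { intros u v Hu Huv Hv. apply ex_RInt_continuous_le; [easy|]. intros z Hz'. apply Hcont. lra. }
  assert (Hzero : forall u v, a <= u -> u <= v -> v <= b ->
    (forall y, u < y < v -> y <= c \/ d <= y) ->
    RInt (fun z => g z * phi z) u v = 0).
  { intros u v Hu Huv Hv Hout.
    rewrite (RInt_ext _ (fun _ => 0)).
    - rewrite RInt_const. apply Rmult_0_r.
    - rewrite Rmin_left, Rmax_right by easy. intros y Hy.
      rewrite Hz by now apply Hout. apply Rmult_0_r. }
  assert (Hcd : 0 < RInt (fun z => g z * phi z) c d).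
  { apply RInt_gt_0; [lra| |].
    - intros y Hy. apply Rmult_lt_0_compat; [|now apply Hp].
      apply He. apply Rabs_lt_between'. lra.
    - intros y Hy. apply Hcont. lra. }
  specialize (H0 phi Hphi).
  (* Splitting at $c$ and $d$ leaves only the positive middle integral, which contradicts [H0]. *)
  rewrite <- (RInt_Chasles _ a c b) in H0 by (apply Hint; lra).
  rewrite <- (RInt_Chasles _ c d b) in H0 by (apply Hint; lra).
  rewrite (Hzero a c) in H0 by (intros; lra).
  rewrite (Hzero d b) in H0 by (intros; lra).
  unfold plus in H0; simpl in H0. lra.
Qed.

Lemma fundamental_lemma a b g x :
  a < b -> (forall y, a <= y <= b -> continuous g y) ->
  (forall phi, test_function a b phi -> RInt (fun y => g y * phi y) a b = 0) ->
  a <= x <= b -> g x = 0.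
Proof.
  intros Hab Hg H0 Hx.
  assert (H1 := fundamental_lemma_pos a b g x Hab Hg H0 Hx).
  assert (H2 : ~ 0 < - g x).
  { apply (fundamental_lemma_pos a b (fun y => - g y)); [easy| | |easy].
    - intros y Hy. apply (continuous_opp g). now apply Hg.
    - intros phi Hphi.
      rewrite (RInt_ext _ (fun y => opp (g y * phi y))).
      + rewrite (RInt_opp (fun y => g y * phi y)).
        * rewrite H0 by easy. unfold opp; simpl; ring.
        * apply ex_RInt_continuous_le; [lra|]. intros y Hy.
          apply (continuous_mult g phi); [now apply Hg|].
          now apply test_function_continuous with a b.
      + intros y _. unfold opp; simpl; ring. }
  lra.
Qed.

(** * Weak variational derivatives *)

Lemma test_function_C_at a b phi k x : test_function a b phi -> C_at k phi x.
Proof.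
  intros [H _]. revert x.
  (* Generalising to all derivatives of [phi] makes the induction go through, since
     [Derive (Derive_n phi n)] is [Derive_n phi (S n)] by computation. *)
  cut (forall n x, C_at k (Derive_n phi n) x); [intros H' x; apply (H' 0%nat)|].
  induction k as [|k IH]; intros n x.
  - apply (ex_derive_continuous (Derive_n phi n)). exact (H (S n) x).
  - split; [|exact (IH (S n) x)].
    apply filter_forall. exact (H (S n)).
Qed.

(** The support stays at a positive distance from $a$ and $b$, so [phi] vanishes near each end point
    and its derivative vanishes there too. This removes the boundary terms when a variation is
    integrated by parts. *)
Lemma test_function_near_boundary a b phi x :
  test_function a b phi -> x <= a \/ b <= x -> phi x = 0 /\ Derive phi x = 0.
Proof.
  intros [_ [c [d [Hc [Hd H0]]]]] Hx.
  assert (Hloc : locally x (fun y => 0 = phi y)).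
  { destruct Hx as [Hx|Hx].
    - apply filter_imp with (2 := open_lt c x ltac:(lra)).
      intros y Hy. symmetry. apply H0. now left.
    - apply filter_imp with (2 := open_gt d x ltac:(lra)).
      intros y Hy. symmetry. apply H0. now right. }
  split; [symmetry; exact (locally_singleton _ _ Hloc)|].
  rewrite <- (Derive_ext_loc (fun _ => 0) phi x Hloc). apply Derive_const.
Qed.

(** Both integrations by parts become one use of the fundamental theorem of calculus: when $v(N -
    M') + v'M$ is differentiated, the two $v'M'$ terms cancel. *)
Lemma is_RInt_green a b (N M v : R -> R) :
  a <= b ->
  (forall x, a <= x <= b -> C_at 1 N x /\ C_at 2 M x /\ C_at 2 v x) ->
  is_RInt (fun x => (Derive N x - Derive_n M 2 x) * v x
                    + N x * Derive v x + M x * Derive_n v 2 x) a b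
    (bracket a b (fun x => v x * (N x - Derive M x) + Derive v x * M x)).
Proof.
  intros Hab H.
  apply (is_RInt_derive (V := R_CompleteNormedModule)
    (fun x => v x * (N x - Derive M x) + Derive v x * M x));
    rewrite Rmin_left, Rmax_right by easy; intros x Hx;
    destruct (H x Hx) as [HN [HM Hv]].
  - auto_derive.
    + repeat split.
      * exact (C_at_ex_derive 1 v x Hv).
      * exact (C_at_ex_derive 0 N x HN).
      * exact (C_at_ex_derive 0 (Derive M) x (proj2 HM)).
      * exact (C_at_ex_derive 0 (Derive v) x (proj2 Hv)).
      * exact (C_at_ex_derive 1 M x HM).
    + change (Derive (fun x0 => Derive M x0) x) with (Derive_n M 2 x).
      change (Derive (fun x0 => Derive v x0) x) with (Derive_n v 2 x).
      change (Derive (fun x0 => N x0) x) with (Derive N x).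
      change (Derive (fun x0 => M x0) x) with (Derive M x).
      change (Derive (fun x0 => v x0) x) with (Derive v x).
      ring.
  - change (C_at 0 (fun x => (Derive N x - Derive_n M 2 x) * v x
                    + N x * Derive v x + M x * Derive_n v 2 x) x).
    apply C_at_plus; [apply C_at_plus|]; apply (C_at_mult 0).
    + apply (continuous_minus (Derive N) (Derive_n M 2)).
      * exact (proj2 HN).
      * exact (C_at_derive_n 0 2 M x HM).
    + exact (C_at_continuous _ _ _ Hv).
    + exact (C_at_continuous _ _ _ HN).
    + exact (C_at_continuous _ _ _ (C_at_Derive _ _ _ Hv)).
    + exact (C_at_continuous _ _ _ HM).
    + exact (C_at_derive_n 0 2 v x Hv).
Qed.

(** The Hamiltonian is quadratic, so its expansion in $\varepsilon$ is exact and nothing has to be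
    differentiated under the integral. The factor 2 on [f1] absorbs the $1/2$. *)
Lemma is_derive_RInt_quadratic (f0 f1 f2 : R -> R) a b :
  ex_RInt f0 a b -> ex_RInt f1 a b -> ex_RInt f2 a b ->
  is_derive (fun e => / 2 * RInt (fun x => f0 x + 2 * e * f1 x + e ^ 2 * f2 x) a b)
    0 (RInt f1 a b).
Proof.
  intros H0 H1 H2.
  apply (is_derive_ext (fun e =>
    / 2 * (RInt f0 a b + 2 * e * RInt f1 a b + e ^ 2 * RInt f2 a b))).
  - intros e. f_equal. symmetry. apply is_RInt_unique.
    apply (is_RInt_plus (fun x => f0 x + 2 * e * f1 x) (fun x => e ^ 2 * f2 x)).
    + apply (is_RInt_plus f0 (fun x => 2 * e * f1 x)).
      * exact (RInt_correct f0 a b H0).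
      * exact (is_RInt_scal f1 a b (2 * e) _ (RInt_correct f1 a b H1)).
    + exact (is_RInt_scal f2 a b (e ^ 2) _ (RInt_correct f2 a b H2)).
  - generalize (RInt f0 a b) (RInt f1 a b) (RInt f2 a b). intros c0 c1 c2.
    auto_derive; [easy|field].
Qed.

(** Serves to replace the merely integrable [dwH] and [dpH] by time derivatives of the solution,
    which agree with them on $[a, b]$ only but are continuous, as uniqueness requires. *)
Lemma weak_variational_derivative_ext a b F u g h :
  a <= b -> (forall x, a <= x <= b -> g x = h x) ->
  is_weak_variational_derivative a b F u g ->
  is_weak_variational_derivative a b F u h.
Proof.
  intros Hab Hgh [Hi H]. split.
  - apply (ex_RInt_ext g); [|exact Hi].
    rewrite Rmin_left, Rmax_right by easy. intros x Hx. apply Hgh. lra.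
  - intros phi Hphi.
    rewrite (RInt_ext_le _ (fun x => g x * phi x) a b Hab); [now apply H|].
    intros x Hx. now rewrite Hgh.
Qed.

(** The derivative in $\varepsilon$ at 0 is unique, so $\int (g - h)\varphi = 0$ for every test
    function, and the fundamental lemma applies. *)
Lemma weak_variational_derivative_unique a b F u g h x :
  a < b ->
  (forall y, a <= y <= b -> continuous g y /\ continuous h y) ->
  is_weak_variational_derivative a b F u g ->
  is_weak_variational_derivative a b F u h ->
  a <= x <= b -> g x = h x.
Proof.
  intros Hab Hc [_ Hg] [_ Hh] Hx. apply Rminus_diag_uniq.
  apply (fundamental_lemma a b (fun y => g y - h y)); [easy| | |easy].
  - intros y Hy. apply (continuous_minus g h); now apply Hc.
  - intros phi Hphi.
    assert (Hi : forall f, (forall y, a <= y <= b -> continuous f y) ->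
      ex_RInt (fun y => f y * phi y) a b).
    { intros f Hf. apply ex_RInt_continuous_le; [lra|]. intros y Hy.
      apply (continuous_mult f phi); [now apply Hf|].
      now apply test_function_continuous with a b. }
    rewrite (RInt_ext _ (fun y => minus (g y * phi y) (h y * phi y))).
    2:{ intros y _. unfold minus, plus, opp; simpl; ring. }
    rewrite (RInt_minus (fun y => g y * phi y) (fun y => h y * phi y))
      by (apply Hi; intros; now apply Hc).
    rewrite <- (is_derive_unique _ _ _ (Hg phi Hphi)).
    rewrite <- (is_derive_unique _ _ _ (Hh phi Hphi)).
    exact (minus_eq_zero _).
Qed.

Lemma Derive_plus_scal (u phi : R -> R) (eps x : R) :
  ex_derive u x -> ex_derive phi x ->
  Derive (fun y => u y + eps * phi y) x = Derive u x + eps * Derive phi x.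
Proof.
  intros Hu Hphi. rewrite Derive_plus; [|exact Hu|now apply @ex_derive_scal].
  now rewrite Derive_scal.
Qed.

Lemma hamiltonian_variation_w a b rho A T0 I E u q :
  a <= b ->
  (forall x, a <= x <= b -> continuous (fun y => / (rho y * A y)) x /\
     C_at 1 T0 x /\ C_at 2 I x /\ C_at 2 E x /\ C_at 4 u x /\ continuous q x) ->
  is_weak_variational_derivative a b
    (fun f => hamiltonian a b rho A T0 I E f q) u
    (fun x => Derive_n (fun y => E y * I y * Derive_n u 2 y) 2 x
              - Derive (fun y => T0 y * Derive u y) x).
Proof.
  intros Hab H.
  set (M := fun y => E y * I y * Derive_n u 2 y).
  set (N := fun y => T0 y * Derive u y).
  assert (HN : forall x, a <= x <= b -> C_at 1 N x).
  { intros x Hx. destruct (H x Hx) as [_ [HT [_ [_ [Hu _]]]]].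
    apply C_at_mult; [easy|].
    now do 2 apply C_at_S_pred; apply C_at_Derive. }
  assert (HM : forall x, a <= x <= b -> C_at 2 M x).
  { intros x Hx. destruct (H x Hx) as [_ [_ [HI [HE [Hu _]]]]].
    repeat apply C_at_mult; try easy. now apply (C_at_derive_n 2 2). }
  split.
  - apply ex_RInt_continuous_le; [easy|]. intros x Hx.
    apply (continuous_minus (Derive_n M 2) (Derive N)).
    + exact (C_at_derive_n 0 2 M x (HM x Hx)).
    + exact (proj2 (HN x Hx)).
  - intros phi Hphi.
    assert (Hp : forall k x, C_at k phi x)
      by (intros; now apply test_function_C_at with a b).
    (* [f0], [f1], [f2] are the coefficients of $1$, $2\varepsilon$, $\varepsilon^2$ in the
       perturbed energy density. *)
    set (f0 := fun x => / (rho x * A x) * q x ^ 2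
      + T0 x * Derive u x ^ 2 + E x * I x * Derive_n u 2 x ^ 2).
    set (f1 := fun x => N x * Derive phi x + M x * Derive_n phi 2 x).
    set (f2 := fun x => T0 x * Derive phi x ^ 2 + E x * I x * Derive_n phi 2 x ^ 2).
    replace (RInt (fun x => (Derive_n M 2 x - Derive N x) * phi x) a b)
      with (RInt f1 a b).
    (* Green's identity with $v = \varphi$ has no boundary terms; subtracting it from the integral
       of [f1] moves the derivatives off $\varphi$. *)
    2:{ assert (G : is_RInt (fun x => (Derive N x - Derive_n M 2 x) * phi x
          + N x * Derive phi x + M x * Derive_n phi 2 x) a b 0).
        { replace 0 with (bracket a b
            (fun x => phi x * (N x - Derive M x) + Derive phi x * M x)).
          { apply is_RInt_green; [easy|].
            intros x Hx. exact (conj (HN x Hx) (conj (HM x Hx) (Hp 2%nat x))). }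
          unfold bracket.
          destruct (test_function_near_boundary a b phi a Hphi) as [-> ->]; [lra|].
          destruct (test_function_near_boundary a b phi b Hphi) as [-> ->]; [lra|].
          ring. }
        assert (Hf1 : ex_RInt f1 a b).
        { apply ex_RInt_continuous_le; [easy|]. intros x Hx.
          refine (C_at_plus 0 _ _ x (C_at_mult 0 _ _ x _ _) (C_at_mult 0 _ _ x _ _)).
          - exact (C_at_continuous _ _ _ (HN x Hx)).
          - exact (proj2 (Hp 1%nat x)).
          - exact (C_at_continuous _ _ _ (HM x Hx)).
          - exact (proj2 (proj2 (Hp 2%nat x))). }
        symmetry. apply is_RInt_unique.
        replace (RInt f1 a b) with (minus (RInt f1 a b) 0).
        - refine (is_RInt_ext _ _ a b _ _
            (is_RInt_minus _ _ a b _ _ (RInt_correct f1 a b Hf1) G)).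
          intros x _. unfold f1, minus, plus, opp; simpl. ring.
        - unfold minus, plus, opp; simpl. ring. }
    apply (is_derive_ext (fun e =>
      / 2 * RInt (fun x => f0 x + 2 * e * f1 x + e ^ 2 * f2 x) a b)).
    + intros e. unfold hamiltonian. f_equal. apply RInt_ext_le; [easy|]. intros x Hx.
      destruct (H x Hx) as [_ [_ [_ [_ [Hu _]]]]].
      rewrite Derive_plus_scal
        by (eapply C_at_ex_derive; first [exact Hu|exact (Hp 1%nat x)]).
      replace (Derive_n (fun y => u y + e * phi y) 2 x)
        with (Derive_n u 2 x + e * Derive_n phi 2 x).
      (* Differentiating a second time needs the first-order identity in a neighbourhood of [x]. *)
      2:{ simpl. symmetry.
          rewrite (Derive_ext_loc (Derive (fun y => u y + e * phi y))
            (fun y => Derive u y + e * Derive phi y)).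
          - apply Derive_plus_scal; eapply C_at_ex_derive;
              [exact (C_at_Derive _ _ _ Hu)|exact (C_at_Derive _ _ _ (Hp 2%nat x))].
          - generalize (filter_and _ _ (proj1 Hu) (proj1 (Hp 1%nat x))).
            apply filter_imp. intros y [H1 H2]. now apply Derive_plus_scal. }
      unfold f0, f1, f2, N, M. ring.
    + apply is_derive_RInt_quadratic; apply ex_RInt_continuous_le; try easy;
        intros x Hx; destruct (H x Hx) as [Hk [HT [HI [HE [Hu Hq]]]]];
        apply C_at_continuous in HT, HI, HE;
        assert (Hu1 := C_at_continuous _ _ _ (C_at_Derive _ _ _ Hu));
        assert (Hu2 := C_at_continuous _ _ _ (C_at_derive_n 2 2 u x Hu));
        assert (Hp1 := C_at_derive_n 0 1 phi x (Hp 1%nat x));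
        assert (Hp2 := C_at_derive_n 0 2 phi x (Hp 2%nat x));
        (* The constant 1 is what remains at the end of an unfolded square. *)
        assert (H1 := C_at_const 0 1 x);
        repeat first [exact H1 | easy | apply (C_at_plus 0) | apply (C_at_mult 0)].
Qed.

Lemma hamiltonian_variation_p a b rho A T0 I E u q :
  a <= b ->
  (forall x, a <= x <= b -> continuous (fun y => / (rho y * A y)) x /\
     C_at 1 T0 x /\ C_at 2 I x /\ C_at 2 E x /\ C_at 4 u x /\ continuous q x) ->
  is_weak_variational_derivative a b
    (fun f => hamiltonian a b rho A T0 I E u f) q
    (fun x => / (rho x * A x) * q x).
Proof.
  intros Hab H. split.
  - apply ex_RInt_continuous_le; [easy|]. intros x Hx.
    destruct (H x Hx) as [Hk [_ [_ [_ [_ Hq]]]]].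
    now apply (C_at_mult 0).
  - intros phi Hphi.
    set (f0 := fun x => / (rho x * A x) * q x ^ 2
      + T0 x * Derive u x ^ 2 + E x * I x * Derive_n u 2 x ^ 2).
    set (f1 := fun x => / (rho x * A x) * q x * phi x).
    set (f2 := fun x => / (rho x * A x) * phi x ^ 2).
    apply (is_derive_ext (fun e =>
      / 2 * RInt (fun x => f0 x + 2 * e * f1 x + e ^ 2 * f2 x) a b)).
    + intros e. unfold hamiltonian. f_equal. apply RInt_ext_le; [easy|].
      intros x _. unfold f0, f1, f2. ring.
    + apply is_derive_RInt_quadratic; apply ex_RInt_continuous_le; try easy;
        intros x Hx; destruct (H x Hx) as [Hk [HT [HI [HE [Hu Hq]]]]];
        apply C_at_continuous in HT, HI, HE;
        assert (Hu1 := C_at_continuous _ _ _ (C_at_Derive _ _ _ Hu));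
        assert (Hu2 := C_at_continuous _ _ _ (C_at_derive_n 2 2 u x Hu));
        assert (Hp0 := test_function_C_at a b phi 0 x Hphi);
        assert (H1 := C_at_const 0 1 x);
        repeat first [exact H1 | easy | apply (C_at_plus 0) | apply (C_at_mult 0)].
Qed.

(** * Smoothness in time and space *)

Lemma continuity_2d_pt_slice f t x : continuity_2d_pt f t x -> continuous (f t) x.
Proof.
  intros Hf P HP.
  assert (H := proj1 (continuity_2d_pt_filterlim f t x) Hf P HP).
  exact (locally_2d_1d_const_x _ _ _
    (proj2 (locally_2d_locally (fun s y => P (f s y)) t x) H)).
Qed.

Lemma open_locally_2d (U : R * R -> Prop) t x :
  open U -> U (t, x) -> locally_2d (fun s y => U (s, y)) t x.
Proof.
  intros HU Hx. apply locally_2d_locally.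
  apply filter_imp with (2 := HU _ Hx). now intros [s y].
Qed.

Lemma C2_on_slice U k f t x :
  open U -> C2_on U k f -> U (t, x) -> C_at k (f t) x.
Proof.
  intros HU. revert f. induction k as [|k IH]; intros f Hf Hx.
  - exact (continuity_2d_pt_slice f t x (proj1 Hf t x Hx)).
  - destruct Hf as [_ [Hd [_ HDx]]]. split.
    + apply filter_imp
        with (2 := locally_2d_1d_const_x _ _ _ (open_locally_2d U t x HU Hx)).
      intros y Hy. exact (proj2 (Hd t y Hy)).
    + exact (IH (Dx f) HDx Hx).
Qed.

(** [C2_on] makes both mixed derivatives continuous without asserting that they agree; Schwarz's
    theorem gives the equality. *)
Lemma Dt_Dx_comm U f t x :
  open U -> C2_on U 2 f -> U (t, x) -> Dt (Dx f) t x = Dx (Dt f) t x.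
Proof.
  intros HU [_ [Hd [[_ [Hdt [_ [HDxDt _]]]] [_ [Hdx [[HDtDx _] _]]]]]] Hx.
  apply (Schwarz f).
  - generalize (open_locally_2d U t x HU Hx). apply locally_2d_impl.
    apply locally_2d_forall. intros s y Hs. repeat split.
    + exact (proj1 (Hd s y Hs)).
    + exact (proj2 (Hd s y Hs)).
    + exact (proj1 (Hdx s y Hs)).
    + exact (proj2 (Hdt s y Hs)).
  - exact (HDtDx t x Hx).
  - exact (HDxDt t x Hx).
Qed.

(** * Differentiating the energy under the integral sign *)

Lemma continuity_2d_pt_space f t x :
  continuous f x -> continuity_2d_pt (fun _ y => f y) t x.
Proof.
  intros H. apply (continuity_1d_2d_pt_comp f (fun _ y => y)).
  - now apply continuity_pt_filterlim.
  - apply continuity_2d_pt_id2.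
Qed.

Lemma is_derive_energy_density k1 k2 k3 (f g h : R -> R) t :
  ex_derive f t -> ex_derive g t -> ex_derive h t ->
  is_derive (fun s => k1 * f s ^ 2 + k2 * g s ^ 2 + k3 * h s ^ 2) t
    (2 * (k1 * f t * Derive f t + k2 * g t * Derive g t + k3 * h t * Derive h t)).
Proof.
  intros Hf Hg Hh. auto_derive; [easy|].
  change (Derive (fun x => f x) t) with (Derive f t).
  change (Derive (fun x => g x) t) with (Derive g t).
  change (Derive (fun x => h x) t) with (Derive h t). ring.
Qed.

(** Leibniz's rule: the time derivative of the density is $2G$, jointly continuous at each point of
    $\{t\} \times [a, b]$, and the $1/2$ of the energy cancels the 2. The [locally] hypothesis keeps
    whole segments $\{s\} \times [a, b]$ in [U] for $s$ near $t$. *)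
Lemma is_derive_RInt_energy_density U a b t (k1 k2 k3 : R -> R)
    (f g h : R -> R -> R) :
  a <= b -> open U ->
  locally t (fun s => forall x, a <= x <= b -> U (s, x)) ->
  (forall x, a <= x <= b -> continuous k1 x /\ continuous k2 x /\ continuous k3 x) ->
  C2_on U 1 f -> C2_on U 1 g -> C2_on U 1 h ->
  is_derive (fun s => / 2 * RInt (fun x =>
      k1 x * f s x ^ 2 + k2 x * g s x ^ 2 + k3 x * h s x ^ 2) a b) t
    (RInt (fun x => k1 x * f t x * Dt f t x + k2 x * g t x * Dt g t x
                    + k3 x * h t x * Dt h t x) a b).
Proof.
  intros Hab HU Hloc Hk Hf Hg Hh.
  set (F := fun s x => k1 x * f s x ^ 2 + k2 x * g s x ^ 2 + k3 x * h s x ^ 2).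
  set (G := fun s x => k1 x * f s x * Dt f s x + k2 x * g s x * Dt g s x
                    + k3 x * h s x * Dt h s x).
  assert (HF : forall s x, U (s, x) ->
    is_derive (fun r => F r x) s (2 * G s x)).
  { intros s x Hs.
    apply (is_derive_energy_density (k1 x) (k2 x) (k3 x)
      (fun r => f r x) (fun r => g r x) (fun r => h r x)).
    - exact (proj1 (proj1 (proj2 Hf) s x Hs)).
    - exact (proj1 (proj1 (proj2 Hg) s x Hs)).
    - exact (proj1 (proj1 (proj2 Hh) s x Hs)). }
  assert (HUt := locally_singleton _ _ Hloc).
  assert (HG : forall x, a <= x <= b -> continuity_2d_pt G t x).
  { intros x Hx. destruct (Hk x Hx) as [K1 [K2 K3]].
    assert (HUx := HUt x Hx).
    repeat apply continuity_2d_pt_plus; repeat apply continuity_2d_pt_mult;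
      try (now apply continuity_2d_pt_space);
      first [ exact (proj1 Hf t x HUx) | exact (proj1 Hg t x HUx)
            | exact (proj1 Hh t x HUx)
            | exact (proj1 (proj1 (proj2 (proj2 Hf))) t x HUx)
            | exact (proj1 (proj1 (proj2 (proj2 Hg))) t x HUx)
            | exact (proj1 (proj1 (proj2 (proj2 Hh))) t x HUx) ]. }
  change (is_derive (fun s => / 2 * RInt (F s) a b) t (RInt (G t) a b)).
  replace (RInt (G t) a b) with (/ 2 * RInt (fun x => Derive (fun s => F s x) t) a b).
  - apply (is_derive_scal (fun s => RInt (F s) a b) t (/ 2)).
    apply (is_derive_RInt_param F a b t);
      try rewrite Rmin_left, Rmax_right by easy.
    + generalize Hloc. apply filter_imp. intros s Hs x Hx.
      eexists. exact (HF s x (Hs x Hx)).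
    (* The partial derivative is known to equal $2G$ only on [U], which suffices because [U] is
       open. *)
    + intros x Hx. apply (continuity_2d_pt_ext_loc (fun s y => 2 * G s y)).
      * generalize (open_locally_2d U t x HU (HUt x Hx)). apply locally_2d_impl.
        apply locally_2d_forall. intros s y Hs.
        symmetry. exact (is_derive_unique _ _ _ (HF s y Hs)).
      * apply (continuity_2d_pt_mult (fun _ _ => 2)).
        -- apply continuity_2d_pt_const.
        -- now apply HG.
    + generalize Hloc. apply filter_imp. intros s Hs.
      apply ex_RInt_continuous_le; [easy|]. intros x Hx.
      destruct (Hk x Hx) as [K1 [K2 K3]].
      assert (Cf := continuity_2d_pt_slice f s x (proj1 Hf s x (Hs x Hx))).
      assert (Cg := continuity_2d_pt_slice g s x (proj1 Hg s x (Hs x Hx))).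
      assert (Ch := continuity_2d_pt_slice h s x (proj1 Hh s x (Hs x Hx))).
      assert (H1 := C_at_const 0 1 x).
      repeat first [exact H1 | easy | apply (C_at_plus 0) | apply (C_at_mult 0)].
  - rewrite (RInt_ext_le _ (fun x => scal 2 (G t x)) a b Hab).
    + rewrite (RInt_scal (G t)).
      * unfold scal; simpl; unfold mult; simpl. field.
      * apply ex_RInt_continuous_le; [easy|]. intros x Hx.
        apply continuity_2d_pt_slice. now apply HG.
    + intros x Hx. apply is_derive_unique. now apply HF, HUt.
Qed.

Lemma C2_on_subset (U V : R * R -> Prop) k f :
  (forall z, V z -> U z) -> C2_on U k f -> C2_on V k f.
Proof.
  intros HVU. revert f. induction k as [|k IH]; intros f [Hc H].
  - split; [|easy]. intros t x Hx. now apply Hc, HVU.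
  - destruct H as [Hd [Ht Hx]]. split; [|split; [|split; now apply IH]].
    + intros t x Htx. now apply Hc, HVU.
    + intros t x Htx. now apply Hd, HVU.
Qed.

Lemma C2_on_S_pred U k f : C2_on U (S k) f -> C2_on U k f.
Proof.
  revert f. induction k as [|k IH]; intros f [Hc [Hd [Ht Hx]]].
  - now split.
  - split; [exact Hc|]. split; [exact Hd|]. split; now apply IH.
Qed.

(** * The energy balance *)

Theorem theorem13 (a b t0 t1 : R) (rho A T0 I E : R -> R) (w p : R -> R -> R)
  (hab : a < b)
  (hpos : forall x, a <= x <= b ->
     0 < rho x /\ 0 < A x /\ 0 < T0 x /\ 0 < I x /\ 0 < E x)
  (hrho : C_segment a b 0 rho) (hA : C_segment a b 0 A)
  (hT0 : C_segment a b 1 T0)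
  (hI : C_segment a b 2 I) (hE : C_segment a b 2 E)
  (hw : C_strip t0 t1 a b 4 w) (hp : C_strip t0 t1 a b 1 p)
  (hsol : euler_bernoulli t0 t1 a b rho A T0 I E w p) :
  forall t, t0 < t < t1 ->
    is_derive (fun s => hamiltonian a b rho A T0 I E (w s) (p s)) t
      (bracket a b (fun x =>
         Dt w t x * (T0 x * Dx w t x
                     - Derive (fun y => E y * I y * Dx (Dx w) t y) x)
         + Dt (Dx w) t x * (E x * I x * Dx (Dx w) t x))).
Proof.
  intros t Ht.
  assert (hab' := Rlt_le _ _ hab).
  destruct hw as [Uw [HUw [HUw' hw]]], hp as [Up [HUp [HUp' hp]]].
  (* [w] and [p] come with different neighbourhoods of the strip; everything is done on their
     intersection. *)
  set (U := fun z => Uw z /\ Up z).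
  assert (HU : open U) by now apply open_and.
  assert (HUs : forall s x, t0 < s < t1 -> a <= x <= b -> U (s, x)).
  { intros s x Hs Hx. split; [now apply HUw'|now apply HUp']. }
  assert (Cw : C2_on U 4 w) by (apply C2_on_subset with (2 := hw); now intros z []).
  assert (Cp : C2_on U 1 p) by (apply C2_on_subset with (2 := hp); now intros z []).
  assert (Cxw : C2_on U 3 (Dx w)) by exact (proj2 (proj2 (proj2 Cw))).
  assert (Ctw : C2_on U 3 (Dt w)) by exact (proj1 (proj2 (proj2 Cw))).
  assert (Cxxw : C2_on U 2 (Dx (Dx w))) by exact (proj2 (proj2 (proj2 Cxw))).
  assert (Ctp : C2_on U 0 (Dt p)) by exact (proj1 (proj2 (proj2 Cp))).
  set (kappa := fun y => / (rho y * A y)).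
  assert (Hcoef : forall x, a <= x <= b -> continuous kappa x /\
     C_at 1 T0 x /\ C_at 2 I x /\ C_at 2 E x /\ C_at 4 (w t) x /\ continuous (p t) x).
  { intros x Hx. refine (conj _ (conj _ (conj _ (conj _ (conj _ _))))).
    - destruct (hpos x Hx) as [Hr [HA _]].
      apply (continuous_comp (fun y => rho y * A y) Rinv).
      + apply (C_at_mult 0); now apply (C_segment_C_at a b).
      + apply continuous_Rinv. now apply Rgt_not_eq, Rmult_lt_0_compat.
    - now apply (C_segment_C_at a b).
    - now apply (C_segment_C_at a b).
    - now apply (C_segment_C_at a b).
    - apply (C2_on_slice U); auto.
    - apply (C_at_continuous 1), (C2_on_slice U); auto. }
  set (N := fun y => T0 y * Dx w t y).
  set (M := fun y => E y * I y * Dx (Dx w) t y).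
  set (v := Dt w t).
  assert (Hgreen : forall x, a <= x <= b -> C_at 1 N x /\ C_at 2 M x /\ C_at 2 v x).
  { intros x Hx. destruct (Hcoef x Hx) as [_ [HT [HI [HE _]]]].
    refine (conj _ (conj _ _)).
    - apply C_at_mult; [easy|]. do 2 apply C_at_S_pred.
      apply (C2_on_slice U); auto.
    - repeat apply C_at_mult; try easy. apply (C2_on_slice U); auto.
    - apply C_at_S_pred, (C2_on_slice U); auto. }
  (* Stated on [U] rather than on $[a, b]$ because [Hv2] differentiates it in $x$, also at the end
     points. *)
  assert (Hv1 : forall x, U (t, x) -> Derive v x = Dt (Dx w) t x).
  { intros x Hx. symmetry. apply (Dt_Dx_comm U w); [easy| |easy].
    now do 2 apply C2_on_S_pred. }
  assert (Hv2 : forall x, U (t, x) -> Derive_n v 2 x = Dt (Dx (Dx w)) t x).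
  { intros x Hx. rewrite (Dt_Dx_comm U (Dx w)); [|easy|now apply C2_on_S_pred|easy].
    apply (Derive_ext_loc (Derive v)).
    generalize (locally_2d_1d_const_x _ _ _ (open_locally_2d U t x HU Hx)).
    apply filter_imp. exact Hv1. }
  (* The strong form of the equations: by uniqueness, the continuous functions $\partial_t w$ and
     $-\partial_t p$ coincide with the classical variational derivatives, up to and including the
     end points. *)
  assert (Heqs : forall x, a <= x <= b ->
    v x = kappa x * p t x /\ Dt p t x = Derive N x - Derive_n M 2 x).
  { destruct (hsol t Ht) as [dwH [dpH [Hw [Hp Heq]]]]. intros x Hx. split.
    - apply (weak_variational_derivative_unique a b
        (fun q => hamiltonian a b rho A T0 I E (w t) q) (p t)
        v (fun y => kappa y * p t y)); try easy.
      + intros y Hy. split.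
        * exact (C_at_continuous 2 v y (proj2 (proj2 (Hgreen y Hy)))).
        * destruct (Hcoef y Hy) as [Hk [_ [_ [_ [_ Hq]]]]]. now apply (C_at_mult 0).
      + apply weak_variational_derivative_ext with (3 := Hp); [easy|].
        intros y Hy. symmetry. now apply Heq.
      + now apply hamiltonian_variation_p.
    - enough (- Dt p t x = Derive_n M 2 x - Derive N x) by lra.
      apply (weak_variational_derivative_unique a b
        (fun u => hamiltonian a b rho A T0 I E u (p t)) (w t)
        (fun y => - Dt p t y) (fun y => Derive_n M 2 y - Derive N y)); try easy.
      + intros y Hy. destruct (Hgreen y Hy) as [HN [HM _]]. split.
        * apply (continuous_opp (Dt p t)).
          apply (C2_on_slice U 0); auto.
        * apply (continuous_minus (Derive_n M 2) (Derive N)).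
          -- exact (C_at_derive_n 0 2 M y HM).
          -- exact (proj2 HN).
      + apply weak_variational_derivative_ext with (3 := Hw); [easy|].
        intros y Hy. destruct (Heq y Hy) as [_ ->]. ring.
      + now apply hamiltonian_variation_w. }
  replace (bracket a b _) with (bracket a b
    (fun x => v x * (N x - Derive M x) + Derive v x * M x)).
  2:{ unfold bracket. rewrite !Hv1 by (apply HUs; lra). reflexivity. }
  (* Green's identity with $v = \partial_t w$ is read backwards, from the boundary terms to an
     integral. *)
  rewrite <- (is_RInt_unique _ _ _ _ (is_RInt_green a b N M v hab' Hgreen)).
  rewrite (RInt_ext_le _ (fun x => kappa x * p t x * Dt p t x
    + T0 x * Dx w t x * Dt (Dx w) t x
    + E x * I x * Dx (Dx w) t x * Dt (Dx (Dx w)) t x) a b hab').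
  - apply (is_derive_RInt_energy_density U a b t kappa T0 (fun x => E x * I x)
      p (Dx w) (Dx (Dx w))); try easy.
    + generalize (filter_and _ _ (open_gt t0 t (proj1 Ht)) (open_lt t1 t (proj2 Ht))).
      apply filter_imp. intros s Hs x Hx. now apply HUs.
    + intros x Hx. destruct (Hcoef x Hx) as [Hk [HT [HI [HE _]]]].
      apply C_at_continuous in HT, HI, HE.
      refine (conj Hk (conj HT _)). now apply (C_at_mult 0).
    + now do 2 apply C2_on_S_pred.
    + now apply C2_on_S_pred.
  (* In the Green integrand $N' - M''$ is $\partial_t p$ and $v$ is $p/(\rho A)$, so its first term
     is $p\,\partial_t p/(\rho A)$; the other two match once $v'$ and $v''$ are written as time
     derivatives. *)
  - intros x Hx. destruct (Heqs x Hx) as [H1 H2].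
    rewrite Hv1, Hv2 by now apply HUs.
    rewrite <- H2, H1. unfold N, M. ring.
Qed.
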